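(* Let $A$ be a Banach algebra. Then: (i) If $A^{***}A^{**}\subseteq \widetilde{wap}(A)$, then $A^{**}A^{**}\subseteq Z_1(A^{**})$. (ii) If $A^{**}=A^{**}\tilde Z_1^\ell(A^{**})$, then $A^{***}A^{**}\subseteq \widetilde{wap}(A)$.
   Context: The second dual $A^{**}$ carries the first Arens product: for $a,b\in A$, $a'\in A^*$, $a'',b''\in A^{**}$, $\langle a'a,b\rangle=\langle a',ab\rangle$, $\langle a''a',a\rangle=\langle a'',a'a\rangle$, $\langle a''b'',a'\rangle=\langle a'',b''a'\rangle$. For $a'''\in A^{***}$ and $a''\in A^{**}$, $a'''a''\in A^{***}$ is defined by $\langle a'''a'',b''\rangle=\langle a''',a''b''\rangle$. A product of two sets denotes the set of all products. Definitions: $Z_1(A^{**})$ is the set of $a''\in A^{**}$ such that $b''\mapsto a''b''$ is weak*-to-weak* continuous on $A^{**}$; $\tilde Z_1^\ell(A^{**})$ is the set of $a''\in A^{**}$ such that $b''\mapsto a''b''$ is weak*-to-weak continuous on $A^{**}$, where weak* means $\sigma(A^{**},A^* )$ and weak means $\sigma(A^{**},A^{***})$; and $$\widetilde{wap}(A)=\{a'''\in A^{***}: a'''a'':A^{**}\to\mathbb C \text{ is weak* continuous for all } a''\in A^{**}\}.$$ *)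

(* Defs.v *)
From HB Require Import structures.
From mathcomp Require Import all_boot all_order all_algebra.
From mathcomp Require Import complex.
From mathcomp Require Import all_classical all_reals topology normedtype.

Set Implicit Arguments.
Unset Strict Implicit.
Unset Printing Implicit Defensive.

Import Order.TTheory GRing.Theory Num.Theory.
Import numFieldTopology.Exports numFieldNormedType.Exports.

Local Open Scope classical_set_scope.
Local Open Scope ring_scope.

(* Banach algebras are not assumed to have a unit, which rules out the ring
   structures of the algebra library. *)
HB.mixin Record CompleteNormedModule_isBanachAlgebra (K : numFieldType) A
    & CompleteNormedModule K A := {
  bmul : A -> A -> A ;
  bmulA : associative bmul ;
  bmul_linearl : forall b, linear (bmul^~ b) ;
  bmul_linearr : forall a, linear (bmul a) ;
  bmul_norm : forall a b, `|bmul a b| <= `|a| * `|b|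
}.

#[short(type="banachAlgType")]
HB.structure Definition BanachAlgebra (K : numFieldType) :=
  {A of CompleteNormedModule K A & CompleteNormedModule_isBanachAlgebra K A}.

Section Dual.
Context {R : realType} (E : normedModType R[i]).

Definition dual_pred : {pred E -> R[i]^o} :=
  [pred f : E -> R[i]^o | `[< linear f /\ continuous f >]].

Lemma dual_pred_submod : submod_closed dual_pred.
Proof.
split.
- apply/asboolP; split; last exact: cst_continuous.
  by move=> k x y; rewrite /= scaler0 addr0.
- move=> k f g /asboolP[lf cf] /asboolP[lg cg]; apply/asboolP; split.
    move=> c x y; rewrite /= !fctE lf lg !scalerDr !scalerA mulrC.
    by rewrite addrACA.
  move=> x; apply: (@cvgD _ _ _ _ _ (fun x => k *: f x) g); last exact: cg.
  by apply: cvgZl_tmp; exact: cf.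
Qed.

HB.instance Definition _ :=
  GRing.isSubmodClosed.Build R[i] (E -> R[i]^o) dual_pred dual_pred_submod.

Record dual := Dual {
  dual_fun :> E -> R[i]^o ;
  dual_funP : dual_fun \in dual_pred }.

HB.instance Definition _ := [isSub for dual_fun].
HB.instance Definition _ := [Choice of dual by <:].
HB.instance Definition _ := [SubChoice_isSubLmodule of dual by <:].


Lemma dualP (f g : dual) : f =1 g -> f = g.
Proof. by move=> fg; apply/val_inj/funext. Qed.

Lemma dual_linear (f : dual) : linear (f : E -> R[i]^o).
Proof. by have /asboolP[] := dual_funP f. Qed.

Lemma dual_continuous (f : dual) : continuous (f : E -> R[i]^o).
Proof. by have /asboolP[] := dual_funP f. Qed.

HB.instance Definition _ (f : dual) :=
  GRing.isLinear.Build R[i] E R[i]^o _ (f : E -> R[i]^o) (dual_linear f).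

(* The operator norm. Norms take their values in [R[i]] and suprema exist in
   [R]; the values of a norm are real, so that taking real parts loses nothing. *)
Definition dual_norm (f : dual) : R :=
  sup [set complex.Re `|f x| | x in [set x : E | `|x| <= 1]].

Lemma ge0_Re (z : R[i]) : 0 <= z -> ((complex.Re z)%:C)%C = z.
Proof. by move=> z0; rewrite RRe_real// ger0_real. Qed.

Lemma dual_has_sup (f : dual) :
  has_sup [set complex.Re `|f x| | x in [set x : E | `|x| <= 1]].
Proof.
split; first by exists (complex.Re `|f 0|), 0; rewrite //= normr0.
have /linear_bounded_continuous/linear_boundedP := @dual_continuous f.
move=> /pinfty_ex_gt0[M M0 fM]; exists (complex.Re M) => _ [x /= x1 <-].
rewrite -lecR !ge0_Re ?(ltW M0)//.
by apply: le_trans (fM x) _; rewrite ler_piMr// ltW.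
Qed.

Lemma dual_norm_le (f : dual) (x : E) :
  `|f x| <= ((dual_norm f)%:C)%C * `|x|.
Proof.
have [->|x0] := eqVneq x 0; first by rewrite linear0 !normr0 mulr0.
have nx0 : 0 < `|x| by rewrite normr_gt0.
rewrite -ler_pdivrMr// mulrC.
have -> : `|x|^-1 * `|f x| = `|f (`|x|^-1 *: x)|.
  by rewrite linearZ normrZ normfV normr_id.
rewrite -[leLHS]ge0_Re// lecR; apply: ub_le_sup; first exact: (dual_has_sup f).2.
by exists (`|x|^-1 *: x); rewrite //= normfZV.
Qed.

Lemma dual_norm_ge (f : dual) (M : R) :
  (forall x, `|x| <= 1 -> `|f x| <= (M%:C)%C) -> dual_norm f <= M.
Proof.
move=> fM; apply: ge_sup; first exact: (dual_has_sup f).1.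
by move=> _ [x x1 <-]; rewrite -lecR ge0_Re ?fM.
Qed.

Lemma dual_norm_ge0 (f : dual) : 0 <= dual_norm f.
Proof.
apply: ub_le_sup; first exact: (dual_has_sup f).2.
by exists 0; [rewrite /= normr0|rewrite linear0 normr0].
Qed.

Lemma dual_normD (f g : dual) :
  ((dual_norm (f + g))%:C <= (dual_norm f)%:C + (dual_norm g)%:C)%C.
Proof.
rewrite -rmorphD lecR; apply: dual_norm_ge => x x1.
rewrite rmorphD (le_trans (ler_normD _ _))// lerD//.
  by apply: le_trans (dual_norm_le f x) _; rewrite ler_piMr// ler0c dual_norm_ge0.
by apply: le_trans (dual_norm_le g x) _; rewrite ler_piMr// ler0c dual_norm_ge0.
Qed.

Lemma dual_normZ_le (k : R[i]) (f : dual) :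
  ((dual_norm (k *: f))%:C <= `|k| * (dual_norm f)%:C)%C.
Proof.
rewrite -[`|k|]ge0_Re// -rmorphM lecR; apply: dual_norm_ge => x x1.
rewrite rmorphM [X in _ <= X * _]ge0_Re// [leLHS]normrZ ler_wpM2l//.
by apply: le_trans (dual_norm_le f x) _; rewrite ler_piMr// ler0c dual_norm_ge0.
Qed.

Lemma dual_norm0_eq0 (f : dual) : ((dual_norm f)%:C)%C = 0 -> f = 0.
Proof.
move=> f0; apply/val_inj/funext => x /=; apply/eqP.
by rewrite -normr_le0; apply: le_trans (dual_norm_le f x) _; rewrite f0 mul0r.
Qed.

Lemma dual_normZ (k : R[i]) (f : dual) :
  ((dual_norm (k *: f))%:C = `|k| * (dual_norm f)%:C)%C.
Proof.
apply/eqP; rewrite eq_le dual_normZ_le/=.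
have [->|k0] := eqVneq k 0; first by rewrite normr0 mul0r ler0c dual_norm_ge0.
rewrite -ler_pdivlMl ?normr_gt0// -normfV.
by rewrite -{1}[f](scalerK k0) dual_normZ_le.
Qed.

HB.instance Definition _ :=
  Lmodule_isNormed.Build R[i] dual dual_normD dual_normZ dual_norm0_eq0.

End Dual.

Section DualTopologies.
Context {R : realType} (E : normedModType R[i]).

(* sigma(E^*, E): the topology induced by the evaluations at points of E. *)
Definition weak_star : Type :=
  initial_topology (fun f : dual E => (f : {ptws E -> R[i]^o})).

HB.instance Definition _ := Topological.on weak_star.

(* sigma(E, E^* ); for E = A^** this is sigma(A^**, A^*** ). *)
Definition weak : Type :=
  initial_topology
    (fun x : E => ((fun f : dual E => f x) : {ptws dual E -> R[i]^o})).

HB.instance Definition _ := Topological.on weak.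

End DualTopologies.

Section DualComp.
Context {R : realType} {E F : normedModType R[i]}.

Lemma dual_comp_subproof (f : dual F) (T : E -> F) (M : R[i]) :
  0 <= M -> linear T -> (forall x, `|T x| <= M * `|x|) ->
  (f : F -> R[i]^o) \o T \in @dual_pred R E.
Proof.
move=> M0 lT bT; apply/asboolP; split.
  by move=> k x y; rewrite /= lT linearP.
pose T' : {linear E -> F} := HB.pack T (GRing.isLinear.Build R[i] E F _ T lT).
move=> x; apply: continuous_comp; last exact: dual_continuous.
apply: (@bounded_linear_continuous _ _ _ T'); apply/linear_boundedP.
exists `|M|; split; first exact: normr_real.
move=> r Mr y; apply: le_trans (bT y) _; rewrite ler_wpM2r//.
exact: le_trans (real_ler_norm (ger0_real M0)) (ltW Mr).
Qed.

(* The bound [M] serves only to make [f \o T] continuous. *)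
Definition dual_comp (f : dual F) (T : E -> F) (M : R[i]) (M0 : 0 <= M)
    (lT : linear T) (bT : forall x, `|T x| <= M * `|x|) : dual E :=
  Dual (dual_comp_subproof f M0 lT bT).

Lemma dual_comp_norm (f : dual F) (T : E -> F) (M : R[i]) (M0 : 0 <= M)
    (lT : linear T) (bT : forall x, `|T x| <= M * `|x|) :
  `|dual_comp f M0 lT bT| <= `|f| * M.
Proof.
rewrite -[X in _ <= _ * X](ge0_Re M0) -[leRHS]rmorphM lecR.
apply: dual_norm_ge => x x1; apply: le_trans (dual_norm_le f (T x)) _.
rewrite rmorphM [X in _ <= _ * X]ge0_Re//; apply: ler_wpM2l.
  by rewrite ler0c dual_norm_ge0.
by apply: le_trans (bT x) _; rewrite ler_piMr.
Qed.

End DualComp.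

Section Arens.
Context {R : realType} {A : banachAlgType R[i]}.

(* <a'a, b> = <a', ab> *)
Definition dual_act (a' : dual A) (a : A) : dual A :=
  dual_comp a' (normr_ge0 a) (bmul_linearr a) (bmul_norm a).

Lemma dual_act_linear (a' : dual A) : linear (dual_act a').
Proof. by move=> k a b; apply: dualP => c; rewrite /= bmul_linearl linearP. Qed.

Lemma dual_act_norm (a' : dual A) (a : A) : `|dual_act a' a| <= `|a'| * `|a|.
Proof. exact: dual_comp_norm. Qed.

(* <a''a', a> = <a'', a'a> *)
Definition bidual_act (a'' : dual (dual A)) (a' : dual A) : dual A :=
  dual_comp a'' (normr_ge0 a') (dual_act_linear a') (dual_act_norm a').

Lemma bidual_act_linear (a'' : dual (dual A)) : linear (bidual_act a'').
Proof.
move=> k f g; apply: dualP => a.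
have e : dual_act (k *: f + g) a = k *: dual_act f a + dual_act g a.
  exact: dualP.
by rewrite /= e linearP.
Qed.

Lemma bidual_act_norm (a'' : dual (dual A)) (a' : dual A) :
  `|bidual_act a'' a'| <= `|a''| * `|a'|.
Proof. exact: dual_comp_norm. Qed.

(* First Arens product: <a''b'', a'> = <a'', b''a'> *)
Definition arens (a'' b'' : dual (dual A)) : dual (dual A) :=
  dual_comp a'' (normr_ge0 b'') (bidual_act_linear b'') (bidual_act_norm b'').

Lemma arens_linear (a'' : dual (dual A)) : linear (arens a'').
Proof.
move=> k f g; apply: dualP => a'.
have e : bidual_act (k *: f + g) a' = k *: bidual_act f a' + bidual_act g a'.
  exact: dualP.
by rewrite /= e linearP.
Qed.

Lemma arens_norm (a'' b'' : dual (dual A)) :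
  `|arens a'' b''| <= `|a''| * `|b''|.
Proof. exact: dual_comp_norm. Qed.

(* <a'''a'', b''> = <a''', a''b''> *)
Definition tridual_act (a''' : dual (dual (dual A))) (a'' : dual (dual A)) :
    dual (dual (dual A)) :=
  dual_comp a''' (normr_ge0 a'') (arens_linear a'') (arens_norm a'').

End Arens.

Section Centers.
Context {R : realType} (A : banachAlgType R[i]).

Definition Z1 : set (dual (dual A)) :=
  [set a'' | continuous (arens a'' : weak_star (dual A) -> weak_star (dual A))].

Definition tilde_Z1l : set (dual (dual A)) :=
  [set a'' |
    continuous (arens a'' : weak_star (dual A) -> weak (dual (dual A)))].

Definition tilde_wap : set (dual (dual (dual A))) :=
  [set a''' | forall a'' : dual (dual A),
    continuous (tridual_act a''' a'' : weak_star (dual A) -> R[i]^o)].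

End Centers.

Arguments Z1 {R} A _.
Arguments tilde_Z1l {R} A _.
Arguments tilde_wap {R} A _.

(* Main.v *)
Require Import Defs.
From HB Require Import structures.
From mathcomp Require Import all_boot all_order all_algebra.
From mathcomp Require Import complex.
From mathcomp Require Import all_classical all_reals topology normedtype.

Import Order.TTheory GRing.Theory Num.Theory.
Import numFieldTopology.Exports numFieldNormedType.Exports.

Local Open Scope classical_set_scope.
Local Open Scope ring_scope.

(** Both parts rest on the identity (ta)b = t(ab) for t in the third dual and
    a, b in the second ([tridual_actA]), which dualizes the associativity of
    the first Arens product ([arensA]), and on testing continuity into an
    initial topology one functional at a time ([continuous_weak_starP],
    [continuous_weakP]).

    For the first part, let t be the evaluation at a functional f in the dual
    of A. Then (tx)y = t(xy) is the map sending z to <(xy)z, f>. It is weak*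
    continuous because tx lies in wap~(A), and since f is arbitrary this says
    that xy lies in Z1.

    For the second part, factor y = uz with z in Z1~. Then
    (tx)y = t(x(uz)) = (t(xu))z is the weak*-to-weak continuous left
    multiplication by z followed by the functional t(xu), hence it is weak*
    continuous. *)

Lemma continuous_ptws {T : topologicalType} {I : Type} {U : topologicalType}
    (f : T -> {ptws I -> U}) :
  (forall i, continuous (fun t => f t i)) -> continuous f.
Proof.
move=> cf t; apply/cvg_sup => i.
apply: (@continuous_comp_initial {ptws I -> U} T U (fun g => g i) f).
exact: cf.
Qed.

Lemma continuous_initial_ptwsP {S : choiceType} {T U : topologicalType}
    {I : eqType} (w : S -> {ptws I -> U}) (f : T -> initial_topology w) :
  continuous f <-> forall i, continuous (fun t => w (f t) i).
Proof.
split=> [cf i t|cf]; last first.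
  by apply: continuous_comp_initial; exact: continuous_ptws.
have cw : continuous (w : initial_topology w -> _) by exact: initial_continuous.
have cwf : continuous (w \o f).
  by move=> s; exact: (continuous_comp (cf s) (cw (f s))).
apply: (@continuous_comp _ _ _ (w \o f) (fun g : {ptws I -> U} => g i)).
  exact: cwf.
exact: (@proj_continuous _ (fun=> U) i).
Qed.

Lemma continuous_weak_starP {R : realType} {E : normedModType R[i]}
    {T : topologicalType} (f : T -> weak_star E) :
  continuous f <->
  forall x, continuous ((fun t => (f t : dual E) x) : T -> R[i]^o).
Proof. exact: continuous_initial_ptwsP. Qed.

Lemma continuous_weakP {R : realType} {E : normedModType R[i]}
    {T : topologicalType} (f : T -> weak E) :
  continuous f <->
  forall h : dual E, continuous ((fun t => h (f t)) : T -> R[i]^o).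
Proof. exact: continuous_initial_ptwsP. Qed.

(** The bound |f x| <= |f| |x| makes the evaluation at x continuous for the
    operator norm on the dual. *)
Lemma bidual_eval_subproof {R : realType} {E : normedModType R[i]} (x : E) :
  (fun f : dual E => f x) \in @dual_pred R (dual E).
Proof.
have lev : linear (fun f : dual E => f x : R[i]^o) by [].
pose ev : {linear dual E -> R[i]^o} :=
  HB.pack (fun f : dual E => f x : R[i]^o)
    (GRing.isLinear.Build R[i] (dual E) R[i]^o _ _ lev).
apply/asboolP; split; first exact: lev.
apply: (@bounded_linear_continuous _ _ _ ev); apply/linear_boundedP.
exists `|x|; split; first exact: normr_real.
move=> r xr f; apply: le_trans (dual_norm_le f x) _.
by rewrite mulrC ler_wpM2r ?ler0c ?dual_norm_ge0 ?ltW.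
Qed.

(** The canonical embedding of a normed space into its bidual. *)
Definition bidual_eval {R : realType} {E : normedModType R[i]} (x : E) :
  dual (dual E) := Dual (bidual_eval_subproof x).

Section ArensAssociativity.
Context {R : realType} {A : banachAlgType R[i]}.
Implicit Types (a b : A) (f : dual A) (x y z : dual (dual A)).

(** The only step that uses the associativity of A; each of the next
    lemmas follows from the one before it by evaluating at a point. *)
Lemma dual_actA f a b : dual_act (dual_act f a) b = dual_act f (bmul a b).
Proof. by apply: dualP => c; rewrite /= bmulA. Qed.

Lemma bidual_dual_actA x f a :
  dual_act (bidual_act x f) a = bidual_act x (dual_act f a).
Proof. by apply: dualP => b; rewrite /= dual_actA. Qed.

Lemma bidual_actA x y f :
  bidual_act (arens x y) f = bidual_act x (bidual_act y f).
Proof. by apply: dualP => a; rewrite /= bidual_dual_actA. Qed.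

Lemma arensA : associative (@arens R A).
Proof. by move=> x y z; apply: dualP => f; rewrite /= bidual_actA. Qed.

Lemma tridual_actA (t : dual (dual (dual A))) x y :
  tridual_act (tridual_act t x) y = tridual_act t (arens x y).
Proof. by apply: dualP => z; rewrite /= arensA. Qed.

End ArensAssociativity.

Theorem mainTheorem3 (R : realType) (A : banachAlgType R[i]) :
  ([set tridual_act t x | t in [set: dual (dual (dual A))]
                        & x in [set: dual (dual A)]] `<=` tilde_wap A ->
   [set arens x y | x in [set: dual (dual A)] & y in [set: dual (dual A)]]
     `<=` Z1 A) /\
  ([set: dual (dual A)]
     = [set arens x y | x in [set: dual (dual A)] & y in tilde_Z1l A] ->
   [set tridual_act t x | t in [set: dual (dual (dual A))]
                        & x in [set: dual (dual A)]] `<=` tilde_wap A).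
Proof.
split=> [wapA _ [x _ [y _ <-]]|factA _ [t _ [x _ <-]] y].
  apply/continuous_weak_starP => a'.
  (* <t, xb> = <xb, a'> for t the evaluation at a', so t(xy) is the a'-coordinate
     of the left multiplication by xy. *)
  have /wapA/(_ y) : [set tridual_act t x | t in setT & x in setT]
      (tridual_act (bidual_eval a') x) by exists (bidual_eval a') => //; exists x.
  by rewrite tridual_actA.
have [u _ [z Zz <-]] :
    [set arens u z | u in setT & z in tilde_Z1l A] y by rewrite -factA.
rewrite tridual_actA arensA -tridual_actA.
exact: ((continuous_weakP _).1 Zz (tridual_act t (arens x u))).
Qed.
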